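(* For every positive integer $k$ there exists a finite family $\mathcal F$ of mixed graphs whose Turán density coefficient $\theta(\mathcal F)$ is an algebraic number of algebraic degree exactly $k$.
   Context: A mixed graph $G$ has a finite vertex set and an edge set; each edge is on a pair of distinct vertices, there is at most one edge on any pair, and each edge is either undirected ($uv$) or directed from a tail $u$ to a head $v$. Let $e_u(G),e_d(G)$ be the numbers of undirected and directed edges, and $\alpha(G)=e_u(G)/\binom{v(G)}{2}$, $\beta(G)=e_d(G)/\binom{v(G)}{2}$. $F\subseteq G$ means there is an injection $\phi:V(F)\to V(G)$ sending each undirected edge of $F$ to a pair joined by an edge of either type in $G$ and each directed edge $u\to v$ of $F$ to the directed edge $\phi(u)\to\phi(v)$ of $G$. For a finite family $\mathcal F$, $G$ is $\mathcal F$-free if $F\not\subseteq G$ for all $F\in\mathcal F$. The Turán density coefficient $\theta(\mathcal F)$ is the maximum $\rho$ such that $\limsup_{n\to\infty}\max\{\alpha(G)+\rho\beta(G): G\ \mathcal F\text{-free on } n \text{ vertices}\}\le 1$; if $\max\beta(G)\to0$ over $\mathcal F$-free $n$-vertex $G$, then $\theta(\mathcal F)=\infty$. *)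

(* Defs.v *)
From HB Require Import structures.
From mathcomp Require Import all_boot all_order all_algebra.
From mathcomp Require Import all_classical all_reals all_analysis.
Set Implicit Arguments.
Unset Strict Implicit.
Unset Printing Implicit Defensive.
Import Order.TTheory GRing.Theory Num.Theory.
Import numFieldNormedType.Exports.
Local Open Scope classical_set_scope.
Local Open Scope ring_scope.

(* [uedge u v]: the pair {u, v} is an undirected edge; [dedge u v]: there is a
   directed edge with tail u and head v. The axioms say that an edge joins two
   distinct vertices (for [dedge] this is [dedge_asym] with u = v) and that any
   pair carries at most one edge. *)
Record mixed_graph := MixedGraph {
  vertex : finType;
  uedge : rel vertex;
  dedge : rel vertex;
  uedge_sym : symmetric uedge;
  uedge_irr : irreflexive uedge;
  dedge_asym : forall u v, dedge u v -> ~~ dedge v u;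
  uedge_dedge : forall u v, uedge u v -> ~~ dedge u v }.

Definition vertex_count (G : mixed_graph) : nat := #|vertex G|.

Definition num_uedges (G : mixed_graph) : nat :=
  #|[set [set p.1; p.2]%SET | p : vertex G * vertex G & uedge p.1 p.2]%SET|.

Definition num_dedges (G : mixed_graph) : nat :=
  #|[set p : vertex G * vertex G | dedge p.1 p.2]%SET|.

Definition adjacent (G : mixed_graph) (u v : vertex G) : bool :=
  [|| uedge u v, dedge u v | dedge v u].

Definition subgraph (F G : mixed_graph) : Prop :=
  exists phi : vertex F -> vertex G,
    [/\ injective phi,
        forall u v, uedge u v -> adjacent (phi u) (phi v)
      & forall u v, dedge u v -> dedge (phi u) (phi v)].

Definition family_free (I : finType) (F : I -> mixed_graph) (G : mixed_graph)
    : Prop :=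
  forall i, ~ subgraph (F i) G.

Section Density.
Variable R : realType.

Definition alpha (G : mixed_graph) : R :=
  (num_uedges G)%:R / 'C(vertex_count G, 2)%:R.

Definition beta (G : mixed_graph) : R :=
  (num_dedges G)%:R / 'C(vertex_count G, 2)%:R.

Variables (I : finType) (F : I -> mixed_graph).

(* Up to isomorphism there are finitely many graphs of order n, so these two
   suprema are maxima; they are -oo when no F-free graph of order n exists. *)
Definition max_density (rho : R) (n : nat) : \bar R :=
  ereal_sup [set x | exists G : mixed_graph,
    [/\ vertex_count G = n, family_free F G & x = (alpha G + rho * beta G)%:E]].

Definition max_beta (n : nat) : \bar R :=
  ereal_sup [set x | exists G : mixed_graph,
    [/\ vertex_count G = n, family_free F G & x = (beta G)%:E]].

Definition admissible (rho : R) : Prop :=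
  (limn_esup (max_density rho) <= 1)%E.

(* The Turan density coefficient as a relation: [is_turan_coeff theta] means
   theta(F) = theta. *)
Definition is_turan_coeff (theta : \bar R) : Prop :=
  match theta with
  | rho%:E => [/\ ~ (max_beta @ \oo --> 0%E), admissible rho
                & forall rho', admissible rho' -> rho' <= rho]
  | +oo%E => max_beta @ \oo --> 0%E
  | -oo%E => False
  end.

Lemma is_turan_coeff_unique (s t : \bar R) :
  is_turan_coeff s -> is_turan_coeff t -> s = t.
Proof.
case: s t => [s||] [t||] //=; try by [move=> [] | move=> ? []].
move=> [_ sa sm] [_ ta tm]; congr EFin.
by apply/eqP; rewrite eq_le sm // tm.
Qed.

Definition is_min_poly (x : R) (p : {poly rat}) : Prop :=
  [/\ p \is monic, root (map_poly ratr p) x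
    & forall q : {poly rat}, q != 0 -> root (map_poly ratr q) x ->
        (size p <= size q)%N].

Definition algebraic_of_degree (x : R) (k : nat) : Prop :=
  exists2 p : {poly rat}, is_min_poly x p & size p = k.+1.

End Density.

(* Main.v *)
Require Import Defs.
From HB Require Import structures.
From mathcomp Require Import all_boot all_order all_algebra.
From mathcomp Require Import all_classical all_reals all_analysis.
From mathcomp Require Import ring lra.
Set Implicit Arguments.
Unset Strict Implicit.
Unset Printing Implicit Defensive.
Import Order.TTheory GRing.Theory Num.Theory.
Import numFieldNormedType.Exports.
(* [adjacent] is also the name of a notion of mathcomp-analysis. *)
Import Defs.
Local Open Scope classical_set_scope.
Local Open Scope ring_scope.

(* Let [D] be a finite graph with spectral radius [l] and let [P] be the
   complete mixed graph whose directed edges are those of [D], oriented along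
   a linear order, the other pairs being undirected edges. Forbid every
   complete mixed graph on at most [v(P) + 1] vertices that is not contained
   in [P]. Zykov symmetrization reduces the Lagrangian of a free graph to
   cliques, and these embed in [P]; as the weight of [P] with coefficient [rho]
   is [(sum x)^2 - sum x^2 + (rho - 1) x^T D x], it stays below [(sum x)^2] on
   all nonnegative [x] exactly when [(rho - 1) l <= 1]. Blow-ups of [P] along
   an approximate Perron vector of [D] show that this is sharp, so the
   coefficient of the family is [1 + 1/l], of the same degree as [l].

   For [D] complete multipartite with [c_i] parts of size [i], [1 <= i <= k],
   [l] is the positive root of [sum_i c_i i / (X + i) = 1], i.e. of the monic
   polynomial [p = prod_i (X + i) - sum_i c_i i prod_(j != i) (X + j)]. The
   [c_i] modulo a prime [q > k] can be chosen by interpolation so that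
   [p = X^k] modulo [q], and changing one [c_i] by [q] ensures that [q^2] does
   not divide [p(0)]; then [p] is an Eisenstein polynomial. *)

(** * Eisenstein polynomials of complete multipartite graphs *)

(** Over the rationals [gcdp p q] vanishes at [x], so it is not constant; by irreducibility it is
    associated to [p], which therefore divides [q]. *)
Lemma irreducible_root_size (R : realFieldType) (p : {poly int}) (x : R) :
  irreducible_poly p -> root (map_poly intr p) x ->
  forall q : {poly rat}, q != 0 -> root (map_poly ratr q) x ->
  (size p <= size q)%N.
Proof.
move=> /irreducible_rat_int p_irr px0 q q0 qx0.
set p' := map_poly intr p in p_irr.
have p'x0 : root (map_poly ratr p') x.
  rewrite -map_poly_comp (@eq_map_poly _ _ _ intr) // => z /=.
  exact: ratr_int.
have gx0 : root (map_poly ratr (gcdp p' q)) x.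
  by rewrite gcdp_map root_gcd p'x0.
have [g1|gN1] := eqVneq (size (gcdp p' q)) 1%N.
  move/eqP/size_poly1P: g1 gx0 => [c c0 ->].
  by rewrite map_polyC /= rootC fmorph_eq0 (negPf c0).
have /eqp_size := p_irr.2 _ gN1 (dvdp_gcdl _ _).
rewrite size_rat_int_poly => <-.
by rewrite dvdp_leq // dvdp_gcdr.
Qed.

(** Two size bounds in place of a minimal polynomial: they transfer easily from [x] to [x + 1] and
    [x^-1], and normalization is left to the end. *)
Definition has_degree (R : realFieldType) (x : R) (k : nat) :=
  (exists q : {poly rat},
     [/\ q != 0, root (map_poly ratr q) x & (size q <= k.+1)%N]) /\
  (forall q : {poly rat}, q != 0 -> root (map_poly ratr q) x ->
     (k < size q)%N).

Lemma has_degree_add1 (R : realFieldType) (x : R) k :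
  has_degree x k -> has_degree (x + 1) k.
Proof.
move=> [[q [q0 qx0 qs]] min]; split.
  exists (q \Po ('X - 1%:P)); split.
  - by rewrite -size_poly_eq0 size_comp_poly2 ?size_XsubC // size_poly_eq0.
  - rewrite map_comp_poly rmorphB /= map_polyX map_polyC /= rmorph1.
    by rewrite root_comp !hornerE addrK.
  - by rewrite size_comp_poly2 ?size_XsubC.
move=> r r0 rx0.
have <- : size (r \Po ('X + 1%:P)) = size r by rewrite size_comp_poly2
  ?size_XaddC.
apply: min.
  by rewrite -size_poly_eq0 size_comp_poly2 ?size_XaddC // size_poly_eq0.
rewrite map_comp_poly rmorphD /= map_polyX map_polyC /= rmorph1.
by rewrite root_comp !hornerE.
Qed.

(** The reciprocal polynomial [X^(deg q) q(1/X)]. Its size drops when [q] vanishes at 0, so in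
    general only an upper bound on it holds. *)
Definition revpoly (F : fieldType) (q : {poly F}) : {poly F} :=
  \poly_(i < size q) q`_(size q - i.+1).

Lemma size_revpoly (F : fieldType) (q : {poly F}) :
  (size (revpoly q) <= size q)%N.
Proof. exact: size_poly. Qed.

Lemma revpoly_eq0 (F : fieldType) (q : {poly F}) : q != 0 -> revpoly q != 0.
Proof.
move=> q0; apply/eqP => /(congr1 (fun r : {poly F} => r`_0)).
rewrite coef_poly coef0 lt0n size_poly_eq0 q0 subn1 => /eqP.
by rewrite -/(lead_coef q) lead_coef_eq0 (negPf q0).
Qed.

Lemma root_revpoly (R : realFieldType) (q : {poly rat}) (x : R) : x != 0 ->
  root (map_poly ratr q) x -> root (map_poly ratr (revpoly q)) x^-1.
Proof.
move=> x0 /rootP qx0; apply/rootP.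
rewrite (@horner_coef_wide _ (size q)) ?size_map_poly ?size_revpoly //.
(* Multiplication by [x ^+ (size q).-1] turns the value at [x^-1] into that of [q] at [x], summed in
   reverse order. *)
apply: (mulfI (expf_neq0 (size q).-1 x0)); rewrite mulr0 -[RHS]qx0.
rewrite horner_coef size_map_poly mulr_sumr (reindex_inj rev_ord_inj) /=.
apply: eq_bigr => i _; rewrite !coef_map /= coef_poly /=.
have iq := ltn_ord i; have jq : (size q - i.+1 < size q)%N.
  by rewrite ltn_subrL ltn0Sn (leq_trans _ iq).
rewrite jq (_ : (size q - (size q - i.+1).+1)%N = i); last first.
  by rewrite subnSK // subKn // ltnW.
rewrite mulrCA; congr (_ * _).
rewrite exprVn -[in LHS](subnK (_ : size q - i.+1 <= (size q).-1)%N);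
  last first.
  by rewrite -subn1 leq_sub2l.
rewrite exprD mulfK ?expf_neq0 //; congr (_ ^+ _).
by rewrite -subn1 -subnDA addnC subnDA subKn // subn1.
Qed.

Lemma has_degree_inv (R : realFieldType) (x : R) k :
  x != 0 -> has_degree x k -> has_degree x^-1 k.
Proof.
move=> x0 [[q [q0 qx0 qs]] min]; split.
  exists (revpoly q); split; first exact: revpoly_eq0.
    exact: root_revpoly.
  exact: leq_trans (size_revpoly q) qs.
move=> r r0 rx0; apply: leq_trans (size_revpoly r).
apply: min; first exact: revpoly_eq0.
by rewrite -[x]invrK root_revpoly ?invr_eq0.
Qed.

Section Multipartite.
Variables (k : nat) (c : 'I_k -> nat).

Definition radius_cofactor (F : comNzRingType) (i : 'I_k) : {poly F} :=
  \prod_(j < k | j != i) ('X + (j.+1)%:R%:P).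

(** The numerator of [1 - sum_i c_i (i + 1) / (X + i + 1)], over any ring: it is read over the
    integers, modulo a prime, over the rationals and over a real field. *)
Definition radius_poly (F : comNzRingType) : {poly F} :=
  \prod_(i < k) ('X + (i.+1)%:R%:P)
  - \sum_(i < k) (c i * i.+1)%:R *: radius_cofactor F i.

Lemma map_radius_poly (F G : comNzRingType) (f : {rmorphism F -> G}) :
  map_poly f (radius_poly F) = radius_poly G.
Proof.
have E (i : 'I_k) : map_poly f ('X + (i.+1)%:R%:P) = 'X + (i.+1)%:R%:P.
  by rewrite rmorphD /= map_polyX map_polyC /= rmorph_nat.
rewrite rmorphB rmorph_prod rmorph_sum /=; congr (_ - _).
  by apply: eq_bigr => i _; exact: E.
apply: eq_bigr => i _; rewrite map_polyZ /= rmorph_nat rmorph_prod.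
by congr (_ *: _); apply: eq_bigr => j _; exact: E.
Qed.

Lemma size_radius_poly_prod (F : idomainType) :
  size (\prod_(i < k) ('X + (i.+1)%:R%:P) : {poly F}) = k.+1.
Proof.
rewrite size_prod; last by move=> j _; rewrite -size_poly_eq0 size_XaddC.
rewrite (eq_bigr (fun=> 2%N)) => [|j _]; last exact: size_XaddC.
by rewrite sum_nat_const card_ord muln2 -addnn -addSn addnK.
Qed.

Lemma size_radius_cofactor (F : idomainType) i : (size (radius_cofactor F i) <=
  k)%N.
Proof.
have := size_radius_poly_prod F; rewrite (bigD1 i) //= mulrC.
rewrite size_Mmonic ?monicXaddC //; last first.
  by apply/prodf_neq0 => j _; rewrite -size_poly_eq0 size_XaddC.
by rewrite size_XaddC addn2 /= => -[->].
Qed.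

Lemma size_radius_poly_sum (F : idomainType) :
  (size (\sum_(i < k) (c i * i.+1)%:R *: radius_cofactor F i)%R <= k)%N.
Proof.
apply: (big_ind (fun p : {poly F} => size p <= k)%N).
- by rewrite size_poly0.
- by move=> p q pk qk; rewrite (leq_trans (size_polyD _ _)) // geq_max pk.
- by move=> i _; rewrite (leq_trans (size_scale_leq _ _)) ?size_radius_cofactor.
Qed.

Lemma size_radius_poly (F : idomainType) : size (radius_poly F) = k.+1.
Proof.
by rewrite /radius_poly size_polyDl ?size_radius_poly_prod //
  size_polyN ltnS size_radius_poly_sum.
Qed.

Lemma radius_poly_monic (F : idomainType) : radius_poly F \is monic.
Proof.
rewrite monicE lead_coefDl ?size_radius_poly_prod ?size_polyN ?ltnS
  ?size_radius_poly_sum //.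
by rewrite -monicE monic_prod // => i _; rewrite monicXaddC.
Qed.

(** At [- (i + 1)] only the [i]-th cofactor survives, so the value involves [c i] alone; this makes
    interpolation possible. *)
Lemma radius_poly_at (F : fieldType) (i : 'I_k) :
  (radius_poly F).[- i.+1%:R] =
  - ((c i * i.+1)%:R * (radius_cofactor F i).[- i.+1%:R]).
Proof.
have Z : ('X + i.+1%:R%:P : {poly F}).[- i.+1%:R] = 0.
  by rewrite !hornerE addNr.
rewrite /radius_poly hornerD hornerN horner_prod (bigD1 i) //= Z mul0r add0r.
congr (- _); rewrite horner_sum (bigD1 i) //= hornerZ big1 ?addr0 // => j ji.
by rewrite hornerZ horner_prod (bigD1 i) ?(eq_sym i) //= Z mul0r mulr0.
Qed.

Lemma radius_poly_at0 (F : idomainType) :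
  (radius_poly F).[0] = (\prod_(i < k) i.+1%:R) * (1 - \sum_(i < k) (c i)%:R).
Proof.
rewrite /radius_poly hornerD hornerN horner_prod horner_sum mulrBr mulr1.
congr (_ - _); first by apply: eq_bigr => i _; rewrite !hornerE.
rewrite mulr_sumr; apply: eq_bigr => i _.
rewrite hornerZ horner_prod [in RHS](bigD1 i) //= natrM mulrC mulrA mulrAC.
rewrite [X in X * _]mulrC; congr (_ * _ * _).
by apply: eq_bigr => j _; rewrite !hornerE.
Qed.

End Multipartite.

Lemma natr_Fp_neq0 (P n : nat) : prime P -> (0 < n < P)%N -> n%:R != 0 :> 'F_P.
Proof.
move=> Pp /andP[n0 nP]; apply/eqP => /(congr1 val) /=.
by rewrite val_Fp_nat ?prime_gt1 // modn_small // => n00; rewrite n00 in n0.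
Qed.

(* Lagrange interpolation at the k points -1, ..., -k, which are distinct
   modulo a prime exceeding k. *)
Lemma radius_poly_interpolation (k P : nat) (f : {poly 'F_P}) : prime P ->
  (k < P)%N -> size f = k.+1 -> f \is monic ->
  exists c : 'I_k -> nat, (forall i, 1 < c i)%N /\ radius_poly c 'F_P = f.
Proof.
move=> Pp kP fs fm.
pose pt (i : 'I_k) : 'F_P := - i.+1%:R.
have rest_neq0 i : (radius_cofactor 'F_P i).[pt i] != 0.
  rewrite horner_prod; apply/prodf_neq0 => j ji; rewrite !hornerE /pt.
  wlog ij : i j ji / (i < j)%N.
    move=> th; case: (ltngtP i j) => [ij|ji'|/val_inj ij]; first exact: th.
    - by rewrite -oppr_eq0 opprD opprK addrC th // eq_sym.
    - by rewrite ij eqxx in ji.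
  rewrite addrC -natrB ?ltnS; last exact: ltnW.
  apply: natr_Fp_neq0 => //; rewrite subSS subn_gt0 ij /=.
  by rewrite (leq_ltn_trans (leq_subr _ _)) // (ltn_trans (ltn_ord j)).
have nat_neq0 (i : 'I_k) : i.+1%:R != 0 :> 'F_P.
  by apply: natr_Fp_neq0 => //=; rewrite (leq_trans _ kP) // ltnS.
(* The residue of [c i] that [radius_poly_at] forces for the value [f.[pt i]]. *)
pose w i := - f.[pt i] / (i.+1%:R * (radius_cofactor 'F_P i).[pt i]).
(* Adding [P] keeps the residue and makes each [c i] exceed 1. *)
exists (fun i => w i + P)%N; split=> [i|].
  by rewrite (leq_trans (prime_gt1 Pp)) // leq_addl.
set c := fun i : 'I_k => _.
have cE i : (c i)%:R = w i.
  by rewrite /c natrD natr_Zp pchar_Fp_0 // addr0.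
(* Two monic polynomials of degree [k] that agree at [k] distinct points are equal, as their
   difference has degree below [k]. *)
apply/eqP; rewrite -subr_eq0; apply: contraT => d0.
have := max_poly_roots d0 (_ : all (root _) (map pt (enum 'I_k))) _.
rewrite size_map size_enum_ord => H.
suff: (k < k)%N by rewrite ltnn.
apply: leq_trans (H _ _) _.
- apply/allP => _ /mapP[i _ ->]; apply/rootP;
  rewrite hornerD hornerN radius_poly_at.
  rewrite natrM cE /w -/(pt i) -mulrA divfK ?mulf_neq0 //.
  by rewrite opprK subrr.
- rewrite map_inj_uniq ?enum_uniq // => i j /oppr_inj /(congr1 val) /=.
  by rewrite !val_Fp_nat ?prime_gt1 // !modn_small ?(leq_ltn_trans (ltn_ord _)
    kP) // => -[/val_inj].
apply/leq_sizeP => j; rewrite leq_eqVlt => /predU1P[<-|kj].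
  have -> : (radius_poly c 'F_P - f)`_k = lead_coef (radius_poly c 'F_P) -
    lead_coef f.
    by rewrite coefB !lead_coefE size_radius_poly fs.
  by rewrite (monicP (radius_poly_monic c _)) (monicP fm) subrr.
by rewrite coefB !nth_default ?subrr ?size_radius_poly ?fs.
Qed.

Lemma irreducible_radius_poly (k : nat) : (0 < k)%N ->
  exists c : 'I_k -> nat, (forall i, 1 < c i)%N /\ irreducible_poly
    (radius_poly c int).
Proof.
move=> k0; have [P kP Pp] := prime_above k.
have := @radius_poly_interpolation k P 'X^k Pp kP.
rewrite size_polyXn => /(_ erefl (monicXn _ _)) [c0 [c0_gt1 c0E]].
have i0 : 'I_k by exact: Ordinal k0.
pose c1 i := (c0 i + P * (i == i0))%N.
have c1E : radius_poly c1 'F_P = 'X^k.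
  rewrite -c0E /radius_poly; congr (_ - _); apply: eq_bigr => i _;
    congr (_ *: _).
  by rewrite !natrM /c1 natrD natrM pchar_Fp_0 // mul0r addr0.
have irr (c : 'I_k -> nat) : radius_poly c 'F_P = 'X^k ->
  ~~ (P%:Z ^+ 2 %| (radius_poly c int)`_0)%Z ->
    irreducible_poly (radius_poly c int).
  move=> cE cP2; apply: (@eisenstein_crit P) => //.
  - by rewrite size_radius_poly eqSS -lt0n.
  - rewrite (monicP (radius_poly_monic c _)).
    rewrite dvdzE /= dvdn1; by case: (P) Pp => [|[]].
  move=> i; rewrite size_radius_poly /= => ik.
  rewrite (dvdz_pcharf (pchar_Fp Pp)) -[_%:~R](coef_map intr) map_radius_poly
    cE.
  by rewrite coefXn ltn_eqF.
case: (boolP (P%:Z ^+ 2 %| (radius_poly c0 int)`_0)%Z) => [d0|]; last first.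
  by move/(irr c0 c0E); exists c0.
exists c1; split=> [i|]; first by rewrite (leq_trans (c0_gt1 i)) ?leq_addr.
apply: irr => //; move: d0; rewrite -!horner_coef0 !radius_poly_at0.
have -> : \sum_i (c1 i)%:R = \sum_i (c0 i)%:R + P%:R :> int.
  rewrite (eq_bigr (fun i => (c0 i)%:R + (P * (i == i0))%:R)) => [|i _].
    rewrite big_split; congr (_ + _).
    by rewrite (bigD1 i0) //= eqxx muln1 big1 ?addr0 // => i /negPf->;
      rewrite muln0.
  by rewrite /c1 natrD.
(* Here [N] is [k!]. The constant terms for [c0] and [c1] differ by [N * P], and [P] does not divide
   [N] since [k < P], so [P ^ 2] cannot divide both. *)
set N := \prod_i _ => d0; rewrite opprD addrA mulrDr rpredDl // mulrN rpredN.
rewrite /N -natr_prod -natrM natz dvdzE expr2 abszM !absz_nat.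
rewrite dvdn_pmul2r ?prime_gt0 // Euclid_dvd_prod //.
rewrite big_has -all_predC; apply/allP => i _ /=.
by rewrite gtnNdvd // (leq_trans _ kP) // ltnS.
Qed.

(* The complete multipartite graph with [c i] parts of size [i + 1] for each
   [i < k] has spectral radius [x], where [x] is the root exhibited here. *)
Lemma multipartite_radius (R : rcfType) (k : nat) : (0 < k)%N ->
  exists (c : 'I_k -> nat) (x : R),
    [/\ 0 < x, \sum_(i < k) (c i * i.+1)%:R / (x + i.+1%:R) = 1
      & has_degree x k].
Proof.
move=> k0; have [c [c1 irr]] := irreducible_radius_poly k0; exists c.
have i0 : 'I_k by exact: Ordinal k0.
have Npos (a : R) : 0 <= a -> 0 < \prod_(i < k) (a + i.+1%:R).
  by move=> a0; apply: prodr_gt0 => i _; rewrite ltr_wpDl.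
have pE (a : R) : 0 <= a -> (radius_poly c R).[a] = \prod_(i < k) (a + i.+1%:R)
  *
    (1 - \sum_(i < k) (c i * i.+1)%:R / (a + i.+1%:R)).
  move=> a0; rewrite /radius_poly hornerD hornerN horner_prod horner_sum mulrBr
    mulr1.
  congr (_ - _); first by apply: eq_bigr => i _; rewrite !hornerE.
  rewrite mulr_sumr; apply: eq_bigr => i _; rewrite hornerZ horner_prod.
  rewrite [in RHS](bigD1 i) //= mulrCA; congr (_ * _).
  rewrite mulrAC mulfV ?mul1r; last by rewrite gt_eqF // ltr_wpDl.
  by apply: eq_bigr => j _; rewrite !hornerE.
have p0 : (radius_poly c R).[0] < 0.
  rewrite radius_poly_at0 pmulr_rlt0 ?subr_lt0; last by apply: prodr_gt0.
  rewrite (bigD1 i0) //= ltr_wpDr ?sumr_ge0 // ltr1n; exact: c1.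
(* [b] is the number of vertices. Each denominator [b + i + 1] is at least [b], so the sum at [b] is
   at most 1 and the polynomial is nonnegative there, while it is negative at 0. *)
pose b : R := \sum_(i < k) (c i * i.+1)%:R.
have b0 : 0 < b.
  rewrite /b (bigD1 i0) //= ltr_wpDr ?sumr_ge0 // ltr0n muln_gt0 /= andbT.
  by rewrite (ltn_trans _ (c1 i0)).
have pb : 0 <= (radius_poly c R).[b].
  rewrite pE ?(ltW b0) // pmulr_rge0 ?Npos ?(ltW b0) // subr_ge0.
  rewrite -[leRHS](mulfV (lt0r_neq0 b0)) /b mulr_suml ler_sum // => i _.
  by rewrite ler_wpM2l // lef_pV2 ?posrE ?ltr_wpDl ?(ltW b0) // lerDl.
have [|x /andP[x0 _] /rootP px] := @poly_ivt _ (radius_poly c R) _ _ (ltW b0).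
  by rewrite ltW.
have {p0}x0 : 0 < x.
  rewrite lt_def x0 andbT; have [x00|//] := eqVneq x 0.
  by rewrite -x00 px x00 ltxx in p0.
exists x; split=> //.
  move: px; rewrite pE ?ltW // => /eqP.
  by rewrite mulf_eq0 (gt_eqF (Npos _ (ltW x0))) /= subr_eq0 => /eqP<-.
split; last first.
  move=> q q0 qx; rewrite -(size_radius_poly c int).
  by apply: irreducible_root_size q0 qx => //; rewrite map_radius_poly;
    apply/rootP.
exists (radius_poly c rat); split.
- by rewrite monic_neq0 ?radius_poly_monic.
- by rewrite map_radius_poly; apply/rootP.
- by rewrite size_radius_poly.
Qed.

(** * Quadratic forms *)

Definition quadform (R : pzSemiRingType) (T : finType) (W : T -> T -> R)
  (x : T -> R) : R := \sum_u \sum_v W u v * (x u * x v).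

(** Weight [s] moves from [v] to [u]. The term in [s ^+ 2] involves only [W u u], [W v v] and
    [W u v], which vanish, so the form is affine in [s]. *)
Lemma quadform_shift (R : comPzRingType) (T : finType) (W : T -> T -> R)
    (x : T -> R) (u v : T) (s : R) :
  (forall a b, W a b = W b a) -> W u u = 0 -> W v v = 0 -> W u v = 0 ->
  quadform W (fun w => x w + s * ((w == u)%:R - (w == v)%:R)) =
  quadform W x + s * (\sum_w W u w * x w - \sum_w W v w * x w) *+ 2.
Proof.
move=> Wsym Wuu Wvv Wuv.
pose e w : R := (w == u)%:R - (w == v)%:R.
have sum_e (f : T -> R) : \sum_w f w * e w = f u - f v.
  rewrite (eq_bigr (fun w => f w * (w == u)%:R - f w * (w == v)%:R));
    last first.
    by move=> w _; rewrite /e mulrBr.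
  rewrite sumrB; congr (_ - _).
    rewrite (bigD1 u) //= eqxx mulr1 big1 ?addr0 // => w /negPf->.
    by rewrite mulr0.
  rewrite (bigD1 v) //= eqxx mulr1 big1 ?addr0 // => w /negPf->.
  by rewrite mulr0.
pose L a := \sum_w W a w * x w.
have inner a : \sum_b W a b * ((x a + s * e a) * (x b + s * e b)) =
    \sum_b W a b * (x a * x b) + s * (W u a * x a - W v a * x a)
    + (s * L a + s * s * (W a u - W a v)) * e a.
  rewrite (eq_bigr (fun b => W a b * (x a * x b) + s * x a * (W a b * e b)
    + s * e a * (W a b * x b) + s * s * e a * (W a b * e b))); last first.
    by move=> b _; ring.
  rewrite !big_split /= -!mulr_sumr !sum_e -/(L a) (Wsym u) (Wsym v).
  by ring.
rewrite /quadform (eq_bigr _ (fun a _ => inner a)) !big_split /= sum_e.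
rewrite -mulr_sumr sumrB Wuu Wvv Wuv [W v u]Wsym Wuv -/(L u) -/(L v).
by ring.
Qed.

(** Of two nonadjacent vertices in the support of [x], the one with the larger partial derivative
    receives all the weight of the other. The total is unchanged, the form does not decrease and the
    support loses a vertex; the induction ends when the support is a clique. *)
Lemma zykov_symmetrization (R : realDomainType) (T : finType) (W : T -> T -> R)
    (adj : rel T) :
  (forall a b, W a b = W b a) -> (forall a b, ~~ adj a b -> W a b = 0) ->
  irreflexive adj -> symmetric adj ->
  (forall x : T -> R, (forall u, 0 <= x u) ->
     (forall u v, x u != 0 -> x v != 0 -> u != v -> adj u v) ->
     quadform W x <= (\sum_u x u) ^+ 2) ->
  forall x : T -> R, (forall u, 0 <= x u) ->
  quadform W x <= (\sum_u x u) ^+ 2.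
Proof.
move=> Wsym W0 adj_irr adj_sym Hclique x.
have [n] := ubnP #|[pred u | x u != 0]|; elim: n x => // n IHn x xn x_ge0.
have [H|] := pselect (forall u v, x u != 0 -> x v != 0 -> u != v -> adj u v).
  exact: Hclique.
move=> /existsNP[u /existsNP[v]].
move=> /not_implyP[xu] /not_implyP[xv] /not_implyP[uv] /negP nadj.
have Wuv := W0 _ _ nadj.
pose L a := \sum_w W a w * x w.
wlog Luv : u v xu xv uv nadj Wuv / L v <= L u.
  move=> th; have [|/ltW] := leP (L v) (L u); first exact: (th u v).
  by apply: (th v u) => //; [rewrite eq_sym|rewrite adj_sym|rewrite Wsym].
pose x' w := x w + x v * ((w == u)%:R - (w == v)%:R).
have Wd a : W a a = 0 by rewrite W0 // adj_irr.
have x'v : x' v = 0.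
  by rewrite /x' eqxx eq_sym (negPf uv) sub0r mulrN1 subrr.
have x'w w : w != u -> w != v -> x' w = x w.
  by move=> /negPf wu /negPf wv; rewrite /x' wu wv subrr mulr0 addr0.
have x'u : x' u = x u + x v.
  by rewrite /x' eqxx (negPf uv) subr0 mulr1.
apply: (@le_trans _ _ (quadform W x')).
  rewrite quadform_shift // lerDl mulrn_wge0 // mulr_ge0 // subr_ge0.
  exact: Luv.
have -> : \sum_u x u = \sum_u x' u.
  rewrite (bigD1 u) //= (bigD1 v) ?(eq_sym v) //= addrA.
  rewrite [RHS](bigD1 u) //= [in RHS](bigD1 v) ?(eq_sym v) //= x'u x'v add0r.
  by congr (_ + _); apply: eq_bigr => w /andP[wu wv]; rewrite x'w.
apply: IHn => [|w]; last first.
  have [->|wu] := eqVneq w u; first by rewrite x'u addr_ge0.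
  by have [->|wv] := eqVneq w v; rewrite ?x'v // x'w.
rewrite -ltnS (leq_trans _ xn) // ltnS; apply: proper_card; apply/properP;
  split.
  apply/fintype.subsetP => w; rewrite !inE.
  have [->//|wu] := eqVneq w u.
  by have [->|wv] := eqVneq w v; rewrite ?x'v ?eqxx // x'w.
by exists v; rewrite inE ?x'v ?eqxx.
Qed.

(* The weights [y] certify, by AM-GM applied to [x u * x v] along each edge,
   that the spectral radius of [e] is at most [l]. *)
Lemma spectral_bound (R : realFieldType) (T : finType) (e : rel T)
    (y : T -> R) (l : R) : symmetric e -> (forall u, 0 < y u) ->
  (forall u, \sum_(v | e u v) y v <= l * y u) ->
  forall x : T -> R,
  \sum_u \sum_(v | e u v) x u * x v <= l * \sum_u x u ^+ 2.
Proof.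
move=> esym y0 yl x.
pose S := \sum_u \sum_(v | e u v) x u ^+ 2 / y u * y v.
have amgm u v : (x u * x v) *+ 2 <= x u ^+ 2 / y u * y v + x v ^+ 2 / y v * y u.
  have yu := lt0r_neq0 (y0 u); have yv := lt0r_neq0 (y0 v).
  rewrite -subr_ge0 (_ : _ - _ =
    y u * y v * (x u / y u - x v / y v) ^+ 2); last by field; apply/andP.
  by rewrite mulr_ge0 ?sqr_ge0 // mulr_ge0 // ltW.
have : (\sum_u \sum_(v | e u v) x u * x v) *+ 2 <= S *+ 2.
  (* Exchanging the two ends of each edge turns [S] into the sum of the other AM-GM terms. *)
  have -> : S *+ 2 = S + \sum_u \sum_(v | e u v) x v ^+ 2 / y v * y u.
    rewrite mulr2n; congr (_ + _); rewrite /S pair_big_dep [RHS]pair_big_dep.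
    rewrite (reindex_inj (h := fun p => (p.2, p.1))) /=; last first.
      by move=> [a b] [c d] [-> ->].
    by apply: eq_bigl => p /=; rewrite esym.
  rewrite -sumrMnl -big_split; apply: ler_sum => u _ /=.
  by rewrite -sumrMnl -big_split; apply: ler_sum => v _ /=.
rewrite ler_pMn2r // => /le_trans; apply.
rewrite mulr_sumr; apply: ler_sum => u _; rewrite -mulr_sumr.
apply: le_trans (ler_wpM2l _ (yl u)) _.
  by rewrite divr_ge0 ?sqr_ge0 // ltW.
by rewrite mulrCA divfK // gt_eqF.
Qed.

(** * Densities of mixed graphs *)

Definition joined (G : mixed_graph) (u v : vertex G) : bool :=
  dedge u v || dedge v u.

Definition edge_weight (R : pzSemiRingType) (rho : R) (G : mixed_graph)
  (u v : vertex G) : R := (uedge u v)%:R + rho * (joined u v)%:R.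

Lemma joined_sym (G : mixed_graph) : symmetric (@joined G).
Proof. by move=> u v; rewrite /joined orbC. Qed.

Lemma dedge_irr (G : mixed_graph) (u : vertex G) : dedge u u = false.
Proof. by apply/negP => duu; have := dedge_asym duu; rewrite duu. Qed.

Lemma joined_irr (G : mixed_graph) : irreflexive (@joined G).
Proof. by move=> u; rewrite /joined dedge_irr. Qed.

Lemma adjacentE (G : mixed_graph) (u v : vertex G) :
  adjacent u v = uedge u v || joined u v.
Proof. by []. Qed.

Lemma adjacent_sym (G : mixed_graph) : symmetric (@adjacent G).
Proof. by move=> u v; rewrite !adjacentE uedge_sym joined_sym. Qed.

Lemma adjacent_irr (G : mixed_graph) : irreflexive (@adjacent G).
Proof. by move=> u; rewrite adjacentE uedge_irr joined_irr. Qed.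

Lemma edge_weight_sym (R : pzSemiRingType) (rho : R) G (u v : vertex G) :
  edge_weight rho u v = edge_weight rho v u.
Proof. by rewrite /edge_weight uedge_sym joined_sym. Qed.

Lemma edge_weight_ge0 (R : numDomainType) (rho : R) (G : mixed_graph) (u v :
  vertex G) :
  0 <= rho -> 0 <= edge_weight rho u v.
Proof. by move=> r0; rewrite addr_ge0 // mulr_ge0. Qed.

(** A pair carries at most one edge, so a directed pair counts 1 as an adjacent pair and [rho - 1]
    on top. The two resulting forms can be bounded separately. *)
Lemma edge_weight_adjacent (R : pzRingType) (rho : R) G (u v : vertex G) :
  edge_weight rho u v = (adjacent u v)%:R + (rho - 1) * (joined u v)%:R.
Proof.
rewrite /edge_weight adjacentE; case: (boolP (uedge u v)) => [uv|_] /=.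
  have -> : joined u v = false.
    apply/negbTE; rewrite negb_or (uedge_dedge uv) uedge_dedge //.
    by rewrite uedge_sym.
  by rewrite !mulr0.
by rewrite mulrBl mul1r add0r addrCA subrr addr0.
Qed.

Lemma sum_uedge (G : mixed_graph) :
  (\sum_(u : vertex G) \sum_(v : vertex G) uedge u v = (num_uedges G).*2)%N.
Proof.
pose h (p : vertex G * vertex G) := [set p.1; p.2]%SET.
have -> : (\sum_(u : vertex G) \sum_(v : vertex G) uedge u v =
    \sum_(p in [pred p : vertex G * vertex G | uedge p.1 p.2]) 1)%N.
  by rewrite pair_bigA /= [RHS]big_mkcond; apply: eq_bigr => p _; rewrite inE;
    case: uedge.
(* Ordered pairs are grouped by their underlying set; each fibre consists of [(u, v)] and
   [(v, u)]. *)
rewrite (partition_big_imset h) /num_uedges -muln2 -sum_nat_const.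
apply: eq_big => [S|S /imsetP[[u v]]]; last rewrite inE /= => uv ->.
  by apply/imsetP/imsetP => -[p pe ->]; exists p => //; move: pe; rewrite !inE.
rewrite sum1_card; have uNv : u != v by apply: contraTneq uv => ->;
  rewrite uedge_irr.
rewrite -(_ : #|[set (u, v); (v, u)]%SET| = 2)%N; last first.
  by rewrite cards2 xpair_eqE negb_and uNv.
apply: eq_card => -[a b]; rewrite !inE /h /=.
apply/andP/orP => [[ab /eqP E]|]; last first.
  move=> [] /eqP[-> ->]; split=> //; first by rewrite inE uedge_sym.
  by rewrite /= finset.setUC.
have aNb : a != b by apply: contraTneq ab => ->; rewrite inE uedge_irr.
have : a \in [set u; v]%SET by rewrite -E !inE eqxx.
have : b \in [set u; v]%SET by rewrite -E !inE eqxx orbT.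
rewrite !inE => /orP[] /eqP eb /orP[] /eqP ea; subst a b.
- by rewrite eqxx in aNb.
- by right.
- by left.
- by rewrite eqxx in aNb.
Qed.

Lemma sum_joined (G : mixed_graph) :
  (\sum_(u : vertex G) \sum_(v : vertex G) joined u v = (num_dedges G).*2)%N.
Proof.
have E : (\sum_(u : vertex G) \sum_(v : vertex G) dedge u v = num_dedges G)%N.
  rewrite /num_dedges -sum1_card pair_bigA /= [RHS]big_mkcond.
  by apply: eq_bigr => p _; rewrite inE; case: dedge.
rewrite -addnn -{1}E -E [X in (_ = _ + X)%N]exchange_big -big_split /=.
apply: eq_bigr => u _; rewrite -big_split; apply: eq_bigr => v _ /=.
rewrite /joined; case: (boolP (dedge u v)) => // /dedge_asym /negbTE ->.
by [].
Qed.

Lemma sum_edge_weight (R : pzRingType) (rho : R) (G : mixed_graph) :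
  quadform (@edge_weight R rho G) (fun=> 1) =
  ((num_uedges G)%:R + rho * (num_dedges G)%:R) *+ 2.
Proof.
rewrite /quadform; under eq_bigr do under eq_bigr do rewrite mulr1 mulr1.
under eq_bigr do rewrite big_split /= -mulr_sumr.
rewrite big_split /= -mulr_sumr.
have N (f : rel (vertex G)) :
    \sum_u \sum_v (f u v)%:R = (\sum_u \sum_v f u v)%N%:R :> R.
  by rewrite natr_sum; apply: eq_bigr => u _; rewrite natr_sum.
by rewrite !N sum_uedge sum_joined -!mul2n !natrM !mulr_natl mulrnDl mulrnAr.
Qed.

Lemma densityE (R : realType) (rho : R) (G : mixed_graph) :
  alpha R G + rho * beta R G = quadform (@edge_weight R rho G) (fun=> 1) /
    (vertex_count G * (vertex_count G).-1)%:R.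
Proof.
rewrite sum_edge_weight /alpha /beta mulrA -mulrDl.
have <- : ('C(vertex_count G, 2) * 2 = vertex_count G * (vertex_count G).-1)%N.
  by rewrite (bin_ffact _ 2) ffactnS ffactn1.
by rewrite natrM -[X in _ = X / _]mulr_natr -mulf_div divff ?mulr1 ?pnatr_eq0.
Qed.

(** * Upper limits of extremal densities *)

Lemma limn_esup_ge (R : realType) (u : (\bar R)^nat) (c : \bar R) :
  (forall N, exists2 n, (N <= n)%N & (c <= u n)%E) -> (c <= limn_esup u)%E.
Proof.
move=> H; apply: le_ereal_inf_tmp => _ [V [N _ NV] <-].
have [n Nn cn] := H N; apply: le_trans cn _; apply: ereal_sup_ubound.
by exists n => //; apply: NV.
Qed.

(** The ratio [n / (n - 1)] is what a bound [n ^ 2] on the quadratic form leaves after division by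
    [n (n - 1)]. *)
Lemma limn_esup_le1 (R : realType) (u : (\bar R)^nat) :
  (forall n, (1 < n)%N -> (u n <= (n%:R / n.-1%:R)%:E)%E) ->
  (limn_esup u <= 1)%E.
Proof.
move=> H; apply/lee_addgt0Pr => e e0.
pose N := (Num.truncn e^-1).+2.
have NV : \oo [set n | N <= n]%N by exists N.
apply: le_trans (_ : ereal_sup (u @` [set n | N <= n]%N) <= _)%E.
  by apply: ereal_inf_lbound; exists [set n | N <= n]%N.
apply: ge_ereal_sup => _ [n /= Nn <-].
have n1 : (1 < n)%N by apply: leq_trans Nn.
apply: le_trans (H n n1) _; rewrite -EFinD lee_fin.
have n0 : 0 < n.-1%:R :> R by rewrite ltr0n -ltnS prednK // ltnW.
rewrite ler_pdivrMr // -{1}(prednK (ltnW n1)) -natr1 mulrDl mul1r lerD2l.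
rewrite -ler_pdivrMl // mulr1; apply: ltW; apply: lt_le_trans (truncnS_gt _) _.
by rewrite ler_nat -ltnS prednK // ltnW.
Qed.

Lemma cvg0_contra (R : realType) (u : (\bar R)^nat) (c : R) : 0 < c ->
  (forall N, exists2 n, (N <= n)%N & (c%:E <= u n)%E) -> ~ (u @ \oo --> 0%E).
Proof.
move=> c0 /limn_esup_ge cu u0; move: cu.
rewrite is_cvg_limn_esupE; last by apply/cvg_ex; exists 0%E.
rewrite (cvg_lim _ u0) //.
by rewrite lee_fin leNgt c0.
Qed.

(** * Complete mixed graphs and the forbidden family *)

Section CompleteMixed.
Variables (V : finType) (d : rel V).

(** Dropping the pairs related both ways makes any relation asymmetric, so every boolean matrix
    codes a complete mixed graph. *)
Definition oneway : rel V := fun u v => d u v && ~~ d v u.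

Definition both_or_none : rel V :=
  fun u v => [&& u != v, ~~ oneway u v & ~~ oneway v u].

Fact both_or_none_sym : symmetric both_or_none.
Proof. by move=> u v; rewrite /both_or_none eq_sym [~~ _ && ~~ _]andbC. Qed.

Fact both_or_none_irr : irreflexive both_or_none.
Proof. by move=> u; rewrite /both_or_none eqxx. Qed.

Fact oneway_asym u v : oneway u v -> ~~ oneway v u.
Proof. by rewrite /oneway => /andP[-> /negPf->]. Qed.

Fact both_or_none_oneway u v : both_or_none u v -> ~~ oneway u v.
Proof. by case/and3P. Qed.

Definition complete_mixed : mixed_graph :=
  MixedGraph both_or_none_sym both_or_none_irr oneway_asym both_or_none_oneway.

Lemma adjacent_complete (u v : vertex complete_mixed) :
  adjacent u v = (u != v).
Proof.
rewrite /adjacent /= /both_or_none; case: eqVneq => [->|_] /=.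
  by rewrite /oneway andbN.
by case: (oneway u v); case: (oneway v u).
Qed.

End CompleteMixed.

(** The order [m] goes up to [v(P) + 1], one beyond [P]: complete graphs of that order never embed
    in [P], which bounds the cliques of a free graph. Indexing by matrices makes the family finite;
    repetitions are harmless. *)
Definition obstruction_index (P : mixed_graph) : finType :=
  {x : {m : 'I_#|vertex P|.+2 & {ffun 'I_m * 'I_m -> bool}}
     | `[< ~ subgraph (complete_mixed (fun i j => tagged x (i, j))) P >]}.

Definition obstruction (P : mixed_graph) (x : obstruction_index P) :
    mixed_graph :=
  complete_mixed (fun i j => tagged (val x) (i, j)).

(** * Upper bound *)

Section Upper.
Variables (P G : mixed_graph).
Hypothesis Gfree : family_free (@obstruction P) G.

(** The orientation of the clique [S] is read off as a boolean matrix. Were the graph that it codes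
    not contained in [P], it would be forbidden, yet it sits in [G] as [S]. *)
Lemma clique_embedding (S : {set vertex G}) (v0 : vertex G) :
  v0 \in S -> {in S &, forall u v, u != v -> adjacent u v} ->
  (#|S| <= #|vertex P|.+1)%N ->
  exists phi : vertex G -> vertex P,
    {in S &, injective phi} /\
    {in S &, forall u v, dedge u v -> dedge (phi u) (phi v)}.
Proof.
move=> v0S Sadj; rewrite -ltnS => Sm.
pose d : {ffun 'I_(Ordinal Sm) * 'I_(Ordinal Sm) -> bool} :=
  [ffun p => dedge (enum_val (A := S) p.1) (enum_val (A := S) p.2)].
pose x : {m : 'I_#|vertex P|.+2 & {ffun 'I_m * 'I_m -> bool}} := Tagged _ d.
have dE (i j : 'I_#|S|) : oneway (fun i j => tagged x (i, j)) i j =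
    dedge (enum_val i) (enum_val j).
  rewrite /oneway /= !ffunE /=; case: (boolP (dedge _ _)) => //=.
  by move/dedge_asym.
have [phi [phi_inj _ phi_d]] :
    subgraph (complete_mixed (fun i j => tagged x (i, j))) P.
  apply: contrapT => Nsub.
  have xP : `[< ~ subgraph (complete_mixed (fun i j => tagged x (i, j))) P >].
    exact/asboolP.
  apply: (Gfree (i := exist _ x xP)); exists (@enum_val _ (mem S)); split.
  - exact: enum_val_inj.
  - move=> i j /and3P[ij _ _]; apply: Sadj; rewrite ?enum_valP //.
    by rewrite (inj_eq enum_val_inj).
  - by move=> i j; rewrite /= dE.
exists (phi \o enum_rank_in v0S); split=> [u v uS vS /= /phi_inj|u v uS vS duv].
  exact: enum_rank_in_inj.
by apply: phi_d; rewrite /= dE !enum_rankK_in.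
Qed.

(** A larger clique contains [v(P) + 1] vertices, which [clique_embedding] would map injectively
    into [P]. *)
Lemma clique_card (S : {set vertex G}) :
  {in S &, forall u v, u != v -> adjacent u v} -> (#|S| <= #|vertex P|)%N.
Proof.
move=> Sadj; rewrite leqNgt; apply/negP => /card_geqP[s [us ss sS]].
have sE : #|[set u in s]| = #|vertex P|.+1 by rewrite cardsE (card_uniqP us).
have [v0 v0s] : exists v0, v0 \in [set u in s]%SET.
  by apply/card_gt0P; rewrite sE.
have [||phi [phi_inj _]] := clique_embedding v0s; last 1 first.
- have := max_card [set phi u | u in [set u in s]]%SET.
  by rewrite card_in_imset // sE ltnn.
- move=> u v; rewrite !inE => /sS uS /sS vS; exact: Sadj.
- by rewrite sE.
Qed.

(** Symmetrization reduces to weights supported on a clique [S]. There the directed part of the form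
    is at most [l] times the sum of squares, and its coefficient [l^-1] turns this into exactly the
    diagonal that the adjacency form lacks. *)
Lemma free_quadform_le (R : realFieldType) (y : vertex P -> R) (l : R) :
  0 < l -> (forall u, 0 < y u) ->
  (forall u, \sum_(v | joined u v) y v = l * y u) ->
  forall x : vertex G -> R, (forall u, 0 <= x u) ->
  quadform (@edge_weight R (1 + l^-1) G) x <= (\sum_u x u) ^+ 2.
Proof.
move=> l0 y0 yl; apply: (zykov_symmetrization (adj := @adjacent G)).
- exact: edge_weight_sym.
- move=> u v uv; rewrite edge_weight_adjacent (negPf uv).
  by move: uv; rewrite adjacentE negb_or => /andP[_ /negPf->];
    rewrite mulr0 addr0.
- exact: adjacent_irr.
- exact: adjacent_sym.
move=> x x0 xadj.
pose S := [set u | x u != 0]%SET.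
have Sadj : {in S &, forall u v, u != v -> adjacent u v}.
  by move=> u v; rewrite !inE; exact: xadj.
pose e u v := [&& joined u v, u \in S & v \in S].
have esym : symmetric e by move=> u v; rewrite /e joined_sym [(u \in S) &&
  _]andbC.
(* The eigenvector [y] of [P] is pulled back along the embedding of [S]: neighbours in [S] go
   injectively to neighbours in [P], so their total is at most [l * z u]. Vertices outside [S] have
   no neighbour for [e]. *)
have [z z0 zl] : exists2 z : vertex G -> R, forall u, 0 < z u &
    forall u, \sum_(v | e u v) z v <= l * z u.
  have [S0|[v0 v0S]] := set_0Vmem S.
    exists (fun=> 1) => // u; rewrite big_pred0 ?mulr1 ?ltW // => v.
    by rewrite /e S0 inE andbF.
  have [phi [phi_inj phi_d]] := clique_embedding v0S Sadj (leqW (clique_card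
    Sadj)).
  exists (y \o phi) => [u|u]; first exact: y0.
  have [uS|uS] := boolP (u \in S); last first.
    rewrite big_pred0 ?mulr_ge0 ?ltW ?y0 // => v.
    by rewrite /e (negPf uS) andbF.
  rewrite -yl /=.
  have phiS : {in [pred v | e u v] &, injective phi}.
    by move=> v w /and3P[_ _ vS] /and3P[_ _ wS]; exact: phi_inj.
  rewrite -(big_imset (fun w => y w) phiS) /=.
  rewrite big_mkcond [leRHS]big_mkcond; apply: ler_sum => w _ /=.
  case: imsetP => [[v /and3P[uv _ vS] ->]|_]; last by case: ifP => // _;
    exact: ltW.
  rewrite /joined; case/orP: uv => /phi_d ->//; by rewrite ?orbT.
have := spectral_bound esym z0 zl x.
have -> : \sum_u \sum_(v | e u v) x u * x v =
    quadform (fun u v => (joined u v)%:R) x.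
  apply: eq_bigr => u _; rewrite big_mkcond; apply: eq_bigr => v _.
  rewrite /e !inE; case: (joined u v); rewrite ?mul0r ?mul1r //=.
  by case: eqVneq => [->|_]; case: eqVneq => [->|_]; rewrite ?mulr0 ?mul0r.
move=> joined_le.
have adj_le : quadform (fun u v => (adjacent u v)%:R) x <=
    (\sum_u x u) ^+ 2 - \sum_u x u ^+ 2.
  rewrite expr2 mulr_suml -sumrB; apply: ler_sum => u _.
  rewrite mulr_sumr (bigD1 u) //= [in leRHS](bigD1 u) //= adjacent_irr mul0r.
  rewrite add0r addrAC subrr add0r; apply: ler_sum => v _.
  by rewrite ler_piMl ?mulr_ge0 // lern1 leq_b1.
have -> : quadform (@edge_weight R (1 + l^-1) G) x =
    quadform (fun u v => (adjacent u v)%:R) x +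
    l^-1 * quadform (fun u v => (joined u v)%:R) x.
  rewrite /quadform mulr_sumr -big_split; apply: eq_bigr => u _ /=.
  rewrite mulr_sumr -big_split; apply: eq_bigr => v _ /=.
  by rewrite edge_weight_adjacent [1 + _]addrC addrK mulrDl -mulrA.
apply: le_trans (lerD adj_le (ler_wpM2l _ joined_le)) _.
  by rewrite invr_ge0 ltW.
by rewrite mulKf ?gt_eqF // subrK.
Qed.

End Upper.

(** * Blow-ups *)

Lemma sum_tag (A : nmodType) (I : finType) (J : I -> finType) (f : I -> A) :
  \sum_(p : {i : I & J i}) f (tag p) = \sum_i f i *+ #|J i|.
Proof.
have := sig_big_dep (idx := 0) (op := +%R) xpredT
  (fun i => xpredT : pred (J i)) (fun i (_ : J i) => f i).
by rewrite /= => <-; apply: eq_bigr => i _; rewrite sumr_const.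
Qed.

Section Blowup.
Variables (P : mixed_graph) (z : vertex P -> nat).

Let V : finType := {u : vertex P & 'I_(z u)}.

Definition blowup : mixed_graph :=
  @MixedGraph V (fun p q => uedge (tag p) (tag q))
    (fun p q => dedge (tag p) (tag q))
    (fun p q => uedge_sym (tag p) (tag q)) (fun p => uedge_irr (tag p))
    (fun p q => @dedge_asym P (tag p) (tag q))
    (fun p q => @uedge_dedge P (tag p) (tag q)).

Lemma sum_blowup (R : pzSemiRingType) (f : vertex P -> R) :
  \sum_(p : vertex blowup) f (tag p) = \sum_u f u * (z u)%:R.
Proof. by rewrite sum_tag; apply: eq_bigr => u _;
  rewrite card_ord mulr_natr. Qed.

Lemma vertex_count_blowup : vertex_count blowup = (\sum_u z u)%N.
Proof.
rewrite /vertex_count card_tagged sumnE big_map big_enum /=.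
by apply: eq_bigr => u _; rewrite card_ord.
Qed.

Lemma quadform_blowup (R : comPzRingType) (W : vertex P -> vertex P -> R) :
  quadform (fun p q : vertex blowup => W (tag p) (tag q)) (fun=> 1) =
  quadform W (fun u => (z u)%:R).
Proof.
rewrite /quadform.
under eq_bigr => p _.
  under eq_bigr do rewrite mulr1 mulr1.
  rewrite (sum_blowup (fun v => W (tag p) v)).
  over.
rewrite (sum_blowup (fun u => \sum_v W u v * (z v)%:R)).
apply: eq_bigr => u _; rewrite mulr_suml; apply: eq_bigr => v _.
by rewrite -mulrA [(z v)%:R * _]mulrC.
Qed.

(** Copies of one vertex are not adjacent, so a complete graph in the blow-up uses at most one copy
    of each and projects injectively to [P]. *)
Lemma blowup_free : family_free (@obstruction P) blowup.
Proof.
move=> x [phi [phi_inj phi_u phi_d]].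
have /asboolP := valP x; apply; exists (tag \o phi); split.
- move=> i j /= Eij; apply/eqP; apply: contraT => ij.
  have : adjacent (i : vertex (obstruction x)) j by rewrite adjacent_complete.
  have Padj : adjacent (tag (phi i)) (tag (phi j)) = false by rewrite Eij
    adjacent_irr.
  rewrite -Padj => /or3P[/phi_u //|/phi_d dij|/phi_d dji].
  by apply/or3P; apply: Or32.
  by apply/or3P; apply: Or33.
- exact: phi_u.
- exact: phi_d.
Qed.

End Blowup.

(** The vector [K * y] is rounded down. The gap [dl] between the two sides grows to [K ^+ 2 * dl],
    while rounding costs at most [K * C]. *)
Lemma integer_weights (R : archiRealFieldType) (T : finType) (W : T -> T -> R)
    (y : T -> R) :
  (forall u v, 0 <= W u v) -> (forall u, 0 <= y u) ->
  (\sum_u y u) ^+ 2 < quadform W y ->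
  exists z : T -> nat, (\sum_u (z u)%:R) ^+ 2 < quadform W (fun u => (z u)%:R).
Proof.
move=> W0 y0; rewrite -subr_gt0; set dl := _ - _ => dl0.
pose C := \sum_u \sum_v W u v * (y u + y v).
have C0 : 0 <= C.
  by apply: sumr_ge0 => u _; apply: sumr_ge0 => v _; rewrite mulr_ge0 ?addr_ge0.
pose K := C / dl + 1.
have K0 : 0 < K by rewrite ltr_wpDl // divr_ge0 // ltW.
have KC : C < K * dl by rewrite mulrDl mul1r divfK ?ltrDl // gt_eqF.
pose z u := Num.truncn (K * y u).
have Ky0 u : 0 <= K * y u by rewrite mulr_ge0 // ltW.
have zle u : (z u)%:R <= K * y u by rewrite truncn_le.
have ltz u : K * y u < (z u)%:R + 1 by rewrite natr1 truncnS_gt.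
exists z; apply: (@le_lt_trans _ _ (K ^+ 2 * (\sum_u y u) ^+ 2)).
  rewrite -exprMn ler_pXn2r ?nnegrE ?sumr_ge0 //.
    by rewrite mulr_sumr; apply: ler_sum.
  by rewrite mulr_ge0 ?sumr_ge0 // ltW.
apply: (@lt_le_trans _ _ (K ^+ 2 * quadform W y - K * C)).
  rewrite ltrBrDr -ltrBrDl -mulrBr -/dl expr2 -mulrA.
  by rewrite ltr_pM2l.
rewrite /quadform /C !mulr_sumr -sumrB; apply: ler_sum => u _.
rewrite !mulr_sumr -sumrB; apply: ler_sum => v _.
rewrite mulrCA [K * (W u v * _)]mulrCA -mulrBr; apply: ler_wpM2l => //.
move: (zle u) (zle v) (ltz u) (ltz v) (Ky0 u) (Ky0 v).
have zv0 : 0 <= (z v)%:R :> R by [].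
have zu0 : 0 <= (z u)%:R :> R by [].
(* Rounding [a = K * y u] and [b = K * y v] down lowers their product by at most [a + b]. *)
have -> : K ^+ 2 * (y u * y v) - K * (y u + y v) =
  (K * y u) * (K * y v) - (K * y u + K * y v) by ring.
move: (K * y u) (K * y v) zv0 zu0 => a b; nra.
Qed.

Section Scaled.
Variables (R : realFieldType) (P : mixed_graph) (z : vertex P -> nat).
Variables (W : vertex P -> vertex P -> R).
Hypothesis W0 : forall u v, 0 <= W u v.

(** Multiplying the class sizes by [N] multiplies both the form and the squared order by [N ^+ 2],
    and dividing by [n (n - 1)] instead of [n ^ 2] only increases the quotient. Thus one good [z]
    gives arbitrarily large dense graphs. *)
Lemma scaled_blowup_ge (N : nat) : (0 < \sum_u z u)%N -> (1 < N)%N ->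
  quadform W (fun u => (z u)%:R) / (\sum_u z u)%:R ^+ 2 <=
  quadform (fun p q : vertex (blowup (fun u => N * z u)%N) =>
      W (tag p) (tag q)) (fun=> 1) /
    (vertex_count (blowup (fun u => N * z u)%N) *
     (vertex_count (blowup (fun u => N * z u)%N)).-1)%:R.
Proof.
move=> s0 N1; rewrite quadform_blowup vertex_count_blowup -big_distrr /=.
set s := (\sum_u z u)%N in s0 *; set Q := quadform W _.
have -> : quadform W (fun u => (N * z u)%:R) = N%:R ^+ 2 * Q.
  rewrite /Q /quadform mulr_sumr; apply: eq_bigr => u _.
  rewrite mulr_sumr; apply: eq_bigr => v _; rewrite !natrM; ring.
have Q0 : 0 <= Q.
  by apply: sumr_ge0 => u _; apply: sumr_ge0 => v _; rewrite !mulr_ge0.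
have N0 : 0 < N%:R :> R by rewrite ltr0n ltnW.
have sR0 : 0 < s%:R :> R by rewrite ltr0n.
have Ns : (1 < N * s)%N by rewrite (leq_trans N1) // leq_pmulr.
have -> : Q / s%:R ^+ 2 = N%:R ^+ 2 * Q / ((N * s) * (N * s))%:R.
  by rewrite !natrM; field; rewrite !gt_eqF.
apply: ler_wpM2l; first by rewrite mulr_ge0 // sqr_ge0.
have Ns0 : (0 < N * s)%N by exact: ltnW.
have Ns1 : (0 < (N * s).-1)%N by rewrite -ltnS prednK.
rewrite lef_pV2 ?posrE ?ltr0n ?(muln_gt0 (N * s)) ?Ns0 ?Ns1 //.
by rewrite ler_nat leq_mul2l leq_pred orbT.
Qed.

End Scaled.

Lemma betaE (R : realType) (G : mixed_graph) :
  beta R G = quadform (fun u v : vertex G => (joined u v)%:R) (fun=> 1) /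
    (vertex_count G * (vertex_count G).-1)%:R.
Proof.
have -> : beta R G = (alpha R G + 1 * beta R G) - (alpha R G + 0 * beta R G).
  by ring.
rewrite !densityE.
rewrite -mulrBl /quadform -sumrB; congr (_ / _); apply: eq_bigr => u _.
rewrite -sumrB; apply: eq_bigr => v _.
by rewrite /edge_weight mul0r mul1r addr0 -mulrBl addrC addKr.
Qed.

(** * The coefficient of a pattern with a positive eigenvector *)

Section PatternCoefficient.
Variables (R : realType) (V : finType) (d : rel V).
Let P := complete_mixed d.
Variables (y : vertex P -> R) (l : R) (v0 : V).
Hypothesis l0 : 0 < l.
Hypothesis y0 : forall u, 0 < y u.
Hypothesis yl : forall u, \sum_(v | joined u v) y v = l * y u.

(** As [P] is complete, its adjacency form is the square of the sum less the diagonal, and the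
    eigenvector equation evaluates the directed part. The excess over the square is positive exactly
    when [rho > 1 + l^-1]. *)
Lemma pattern_quadform (rho : R) :
  quadform (@edge_weight R rho P) y =
  (\sum_u y u) ^+ 2 + ((rho - 1) * l - 1) * \sum_u y u ^+ 2.
Proof.
rewrite expr2 mulr_suml mulr_sumr -big_split /quadform;
  apply: eq_bigr => u _ /=.
have -> : \sum_v edge_weight rho u v * (y u * y v) =
    y u * \sum_(v | v != u) y v + (rho - 1) * (y u * \sum_(v | joined u v) y v).
  rewrite [\sum_(v | v != u) _]big_mkcond [\sum_(v | joined u v) _]big_mkcond.
  rewrite !mulr_sumr -big_split; apply: eq_bigr => v _ /=.
  rewrite edge_weight_adjacent adjacent_complete eq_sym.
  move: (y u) (y v) => a b.
  by case: (v != u); case: joined => /=; ring.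
rewrite yl [\sum_v y v](bigD1 u) //=.
by move: (y u) (\sum_(v | v != u) y v) => a b; ring.
Qed.

Lemma sum_sqr_gt0 : 0 < \sum_u y u ^+ 2.
Proof.
rewrite (bigD1 v0) //= ltr_wpDr ?exprn_gt0 // sumr_ge0 // => u _.
exact: sqr_ge0.
Qed.

Lemma dense_blowups (rho : R) : 1 + l^-1 < rho ->
  exists z : vertex P -> nat,
    (\sum_u (z u)%:R) ^+ 2 < quadform (@edge_weight R rho P) (fun u => (z
      u)%:R).
Proof.
move=> rho_gt; apply: (integer_weights (y := y)).
- move=> u v; apply: edge_weight_ge0; apply: ltW; apply: lt_trans rho_gt.
  by rewrite addr_gt0 ?invr_gt0.
- by move=> u; exact: ltW.
rewrite pattern_quadform ltrDl mulr_gt0 ?sum_sqr_gt0 //.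
by rewrite subr_gt0 -ltr_pdivrMr // div1r ltrBrDl.
Qed.

Lemma frequently_blowup (z : vertex P -> nat) (N : nat) :
  (0 < \sum_u z u)%N ->
  exists2 M, (1 < M)%N & (N <= vertex_count (blowup (fun u => M * z u)))%N.
Proof.
move=> s0; exists N.+2 => //; rewrite vertex_count_blowup -big_distrr /=.
by rewrite (leq_trans (leqW (leqnSn N))) // leq_pmulr.
Qed.

Lemma pattern_turan_coeff : is_turan_coeff (@obstruction P) (1 + l^-1)%:E.
Proof.
have dense rho : 1 + l^-1 < rho -> exists z : vertex P -> nat,
    (0 < \sum_u z u)%N /\
    1 < quadform (@edge_weight R rho P) (fun u => (z u)%:R) / (\sum_u z u)%:R
      ^+ 2.
  move=> /dense_blowups[z zlt]; exists z.
  have s0 : (0 < \sum_u z u)%N.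
    rewrite lt0n; apply: contraTneq zlt => s0.
    have z0 u : z u = 0%N.
      by apply/eqP; move/eqP: s0; rewrite sum_nat_eq0 => /forallP/(_ u).
    rewrite -leNgt /quadform big1 ?sqr_ge0 // => u _; rewrite big1 // => v _.
    by rewrite !z0 mul0r mulr0.
  by split=> //; rewrite ltr_pdivlMr ?mul1r ?natr_sum //
    -natr_sum exprn_gt0 ?ltr0n.
split.
(* Any [rho] above the threshold would do. The adjacency form alone stays within the square, so a
   ratio above 1 forces a positive directed part [c], which bounds [beta] from below on large
   blow-ups. *)
- have [z [s0 zgt]] : exists z : vertex P -> nat, (0 < \sum_u z u)%N /\
      1 < quadform (@edge_weight R (2 + l^-1) P) (fun u => (z u)%:R)
        / (\sum_u z u)%:R ^+ 2.
    by apply: dense; rewrite ltrD2r ltr1n.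
  have sR0 : 0 < (\sum_u z u)%:R ^+ 2 :> R by rewrite exprn_gt0 ?ltr0n.
  pose c := quadform (fun u v : vertex P => (joined u v)%:R) (fun u => (z u)%:R)
    / (\sum_u z u)%:R ^+ 2 : R.
  have c0 : 0 < c.
    rewrite divr_gt0 //; move: zgt; rewrite ltr_pdivlMr // mul1r.
    have adj_le : quadform (fun u v : vertex P => (adjacent u v)%:R)
        (fun u => (z u)%:R) <= (\sum_u z u)%:R ^+ 2 :> R.
      rewrite natr_sum expr2 mulr_suml; apply: ler_sum => u _.
      rewrite mulr_sumr; apply: ler_sum => v _.
      by rewrite ler_piMl ?mulr_ge0 // lern1 leq_b1.
    have -> : quadform (@edge_weight R (2 + l^-1) P) (fun u => (z u)%:R) =
        quadform (fun u v : vertex P => (adjacent u v)%:R) (fun u => (z u)%:R) +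
        (1 + l^-1) * quadform (fun u v : vertex P => (joined u v)%:R)
          (fun u => (z u)%:R).
      rewrite /quadform mulr_sumr -big_split; apply: eq_bigr => u _ /=.
      rewrite mulr_sumr -big_split; apply: eq_bigr => v _ /=.
      rewrite edge_weight_adjacent mulrDl -!mulrA; congr (_ + _ * _); ring.
    move=> /(le_lt_trans adj_le); rewrite ltrDl pmulr_rgt0 //.
    by rewrite addr_gt0 ?invr_gt0.
  apply: (cvg0_contra c0) => N.
  have [M M1 MN] := frequently_blowup N s0.
  exists (vertex_count (blowup (fun u => M * z u)%N)) => //.
  apply: (@le_trans _ _ (beta R (blowup (fun u => M * z u)%N))%:E).
    by rewrite lee_fin betaE; apply: scaled_blowup_ge.
  apply: ereal_sup_ubound; exists (blowup (fun u => M * z u)%N); split=> //.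
  exact: blowup_free.
(* Admissibility: with all weights 1, [free_quadform_le] bounds the density by
   [n ^ 2 / (n (n - 1))]. *)
- apply: limn_esup_le1 => n n1; apply: ge_ereal_sup => _ [G [Gn Gfree ->]].
  rewrite lee_fin densityE Gn.
  have := free_quadform_le Gfree l0 y0 yl (fun=> ler01).
  rewrite sumr_const -[#|_|]/(vertex_count G) Gn => H.
  have n0 : 0 < n%:R :> R by rewrite ltr0n ltnW.
  have n10 : 0 < n.-1%:R :> R by rewrite ltr0n -ltnS prednK // ltnW.
  rewrite natrM ler_pdivrMr ?mulr_gt0 //; apply: le_trans H _.
  by rewrite mulrA mulrAC divfK ?gt_eqF // expr2.
(* Maximality: above the threshold, blow-ups of arbitrarily large order have density at least a
   constant exceeding 1. *)
move=> rho rho_adm; rewrite leNgt; apply/negP => /[dup] rho_gt /dense[z [s0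
  zgt]].
have rho0 : 0 <= rho.
  by apply: ltW; apply: lt_trans rho_gt; rewrite addr_gt0 ?invr_gt0.
suff : ((quadform (@edge_weight R rho P) (fun u => (z u)%:R)
    / (\sum_u z u)%:R ^+ 2)%:E <= limn_esup (max_density (@obstruction P)
      rho))%E.
  by move/le_trans => /(_ _ rho_adm); rewrite lee_fin leNgt zgt.
apply: limn_esup_ge => N.
have [M M1 MN] := frequently_blowup N s0.
exists (vertex_count (blowup (fun u => M * z u)%N)) => //.
pose G := blowup (fun u => M * z u)%N.
apply: (@le_trans _ _ (alpha R G + rho * beta R G)%:E).
  rewrite lee_fin densityE; apply: scaled_blowup_ge => // u v.
  exact: edge_weight_ge0.
apply: ereal_sup_ubound; exists G; split=> //; exact: blowup_free.
Qed.

End PatternCoefficient.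

(** * Complete multipartite patterns *)

Lemma joined_transversal (I : eqType) (V : finType) (part : V -> I)
    (u v : vertex (complete_mixed
       (fun u v => (part u != part v) && (enum_rank u < enum_rank v)%N))) :
  joined u v = (part u != part v).
Proof.
rewrite /joined /= /oneway [part v == _]eq_sym.
have [//|uv] := eqVneq (part u) (part v).
have : enum_rank u != enum_rank v by rewrite (inj_eq enum_rank_inj);
  apply: contraNneq uv => ->.
by rewrite -(inj_eq val_inj) /= neq_ltn => /orP[] uv';
  rewrite uv' ltnNge ltnW //= orbT.
Qed.

Theorem theorem1p10 (R : realType) (k : nat) (hk : (0 < k)%N) :
  exists (I : finType) (F : I -> mixed_graph) (theta : R),
    is_turan_coeff F theta%:E /\ algebraic_of_degree theta k.
Proof.
have [c [x [x0 sum1 xk]]] := multipartite_radius R hk.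
pose part : finType := {i : 'I_k & 'I_(c i)}.
pose V : finType := {w : part & 'I_(tag w).+1}.
pose d (u v : V) := (tag u != tag v) && (enum_rank u < enum_rank v)%N.
(* The eigenvector is constant on parts: with total 1, its value [t] on a part of size [m] satisfies
   [1 - m t = x t], so [t = 1 / (x + m)]. *)
pose g (w : part) : R := (x + (tag w).+1%:R)^-1.
pose y (v : vertex (complete_mixed d)) := g (tag (v : V)).
have y0 v : 0 < y v by rewrite invr_gt0 ltr_wpDr.
(* That the total is 1 is the equation satisfied by [x]. *)
have sum_y : \sum_v y v = 1.
  rewrite [LHS](@sum_tag _ _ (fun w : part => 'I_(tag w).+1) g).
  rewrite -sum1; under eq_bigr do rewrite card_ord.
  rewrite (@sum_tag _ _ (fun i : 'I_k => 'I_(c i))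
    (fun i => (x + i.+1%:R)^-1 *+ i.+1)).
  by apply: eq_bigr => i _; rewrite card_ord -mulrnA mulrC mulr_natr mulnC.
have yx u : \sum_(v | joined u v) y v = x * y u.
  rewrite (eq_bigl (fun v : V => tag v != tag (u : V))); last first.
    by move=> v; rewrite joined_transversal eq_sym.
  have : \sum_(v : V | tag v == tag (u : V)) y v = y u *+ (tag (tag (u :
    V))).+1.
    rewrite big_mkcond [LHS](@sum_tag _ _ (fun w : part => 'I_(tag w).+1)
      (fun w => if w == tag (u : V) then g w else 0)).
    by rewrite (bigD1 (tag (u : V))) //= eqxx card_ord big1 ?addr0 //
      => w /negPf->; rewrite mul0rn.
  move: sum_y; rewrite (bigID (fun v : V => tag v == tag (u : V))) /=.
  move=> /(canRL (addKr _)) -> ->; rewrite addrC.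
  pose n : R := (tag (tag (u : V))).+1%:R; have -> : y u = (x + n)^-1 by [].
  have n0 : x + n != 0 by rewrite gt_eqF // ltr_wpDr.
  by rewrite -mulr_natr -/n -[X in X - _](mulVf n0) -mulrBr addrK mulrC.
have [v0 _|V0] := pickP (xpredT : pred V); last first.
  by move: sum_y => /eqP; rewrite big_pred0 // eq_sym oner_eq0.
exists _, (@obstruction (complete_mixed d)), (1 + x^-1); split.
  exact: pattern_turan_coeff yx.
have [[q [q0 qx qs]] qmin] : has_degree (1 + x^-1) k.
  by rewrite addrC; apply: has_degree_add1; apply: has_degree_inv;
    rewrite ?gt_eqF.
have ql : lead_coef q != 0 by rewrite lead_coef_eq0.
exists ((lead_coef q)^-1 *: q); last first.
  by rewrite size_scale ?invr_eq0 //; apply/eqP; rewrite eqn_leq qs qmin.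
split.
- by rewrite monicE lead_coefZ mulVf.
- by rewrite map_polyZ rootZ ?fmorph_eq0 ?invr_eq0.
- move=> r r0 rx; rewrite size_scale ?invr_eq0 //.
  by apply: leq_trans qs _; exact: qmin.
Qed.
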